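(* Consider all choices of an integer $k\ge 2$, positive integers $c_1,\dots,c_k$, and positive integer initial values $f[1],\dots,f[k]$, with the sequence $(f[n])_{n\ge1}$ determined by $f[n]=c_1f[n-1]+\cdots+c_kf[n-k]$ for $n>k$. For each positive integer $N$ let $\bar{X}_N$ and $\underline{X}_N$ be random variables with values in $\{1,\dots,N\}$ and $$P(\bar{X}_N=n)=\frac{f[n]}{\sum_{j=1}^{N}f[j]},\qquad P(\underline{X}_N=n)=\frac{f[N+1-n]}{\sum_{j=1}^{N}f[j]}\qquad(1\le n\le N).$$ Let $\varphi=\frac{1+\sqrt5}{2}$. Then, over all such choices, the maximum of $\lim_{N\to\infty}E(\underline{X}_N)$ equals $\varphi+1$, and the maximum of $\lim_{N\to\infty}\mathrm{Var}(\bar{X}_N)$ and the maximum of $\lim_{N\to\infty}\mathrm{Var}(\underline{X}_N)$ both equal $2\varphi+1$; these values are the ones obtained for $k=2$, $c_1=c_2=1$ (the Fibonacci recurrence).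
   Context: $E$ and $\mathrm{Var}$ denote expectation and variance. *)

(* Defs.v *)
From mathcomp Require Import all_boot all_order all_algebra.
From mathcomp Require Import all_classical all_reals all_analysis.

Set Implicit Arguments.
Unset Strict Implicit.
Unset Printing Implicit Defensive.

Import Order.TTheory GRing.Theory Num.Theory.
Import numFieldNormedType.Exports.

Local Open Scope classical_set_scope.
Local Open Scope ring_scope.

(** Indices start at 1: the coefficients are [c 1, ..., c k] and the sequence is
    [f 1, f 2, ...].  The values [c 0], [f 0] and [c i] for [i > k] play no
    role, and the subtraction [n - i] is never truncated, as [i <= k < n]. *)
Definition positive_linear_recurrence (k : nat) (c f : nat -> nat) : Prop :=
  [/\ (2 <= k)%N,
      forall i, (1 <= i <= k)%N -> (0 < c i)%N,
      forall i, (1 <= i <= k)%N -> (0 < f i)%N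
    & forall n, (k < n)%N -> f n = (\sum_(1 <= i < k.+1) c i * f (n - i))%N].

(** A real random variable packed with its probability space, so that the
    members of a sequence may live on different spaces. *)
Record real_rv (R : realType) := RealRV {
  rv_display : measure_display;
  rv_space : measurableType rv_display;
  rv_prob : probability rv_space R;
  rv_fun : {RV rv_prob >-> R}
}.

Definition expect (R : realType) (X : real_rv R) : \bar R :=
  'E_(rv_prob X)[rv_fun X].

Definition var (R : realType) (X : real_rv R) : \bar R :=
  'V_(rv_prob X)[rv_fun X].

Definition has_law_upto (R : realType) (N : nat) (p : nat -> R)
    (X : real_rv R) : Prop :=
  (forall w : rv_space X, exists2 n, (1 <= n <= N)%N & rv_fun X w = n%:R) /\
  (forall n, (1 <= n <= N)%N ->
     rv_prob X (rv_fun X @^-1` [set n%:R]) = (p n)%:E).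

(** The laws of the sequences written [\bar X_N] and [\underline X_N];
    [X 0] is unconstrained. *)
Definition bar_law (R : realType) (f : nat -> nat) (X : nat -> real_rv R) :
    Prop :=
  forall N, (0 < N)%N ->
    has_law_upto N
      (fun n => (f n)%:R / (\sum_(1 <= j < N.+1) f j)%N%:R) (X N).

Definition underline_law (R : realType) (f : nat -> nat)
    (X : nat -> real_rv R) : Prop :=
  forall N, (0 < N)%N ->
    has_law_upto N
      (fun n => (f (N + 1 - n)%N)%:R / (\sum_(1 <= j < N.+1) f j)%N%:R) (X N).

(** All finite values of [lim_N T(X_N)], for [T] an expectation or a variance,
    when the recurrence, the initial values and the variables [X_N] of the
    corresponding law vary. *)
Definition limit_values (R : realType)
    (law : (nat -> nat) -> (nat -> real_rv R) -> Prop)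
    (T : real_rv R -> \bar R) : set R :=
  [set l | exists (k : nat) (c f : nat -> nat) (X : nat -> real_rv R),
     [/\ positive_linear_recurrence k c f, law f X
       & T (X N) @[N --> \oo] --> l%:E]].

Definition is_maximum (R : realType) (A : set R) (m : R) : Prop :=
  A m /\ ubound A m.

(* Main.v *)
(** Let [x] be the root of [c_1 x + ... + c_k x^k = 1] in ]0, 1[, the inverse of
    the dominant root of the recurrence.  The sequence [g n = f n * x ^ n]
    satisfies [g n = p_1 g (n - 1) + ... + p_k g (n - k)] with convex weights
    [p_i = c_i x^i].  The oscillation of [g] over [k] consecutive terms is
    multiplied by at most [1 - p_1 ^ k] every [k] steps, so that
    [f n / f (n + 1)] tends to [x].  For a positive sequence [u] with
    [u n / u (n + 1)] tending to [x], the ratio of the partial sums of [u] to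
    [u] tends to [L = 1 / (1 - x)], and the partial sums satisfy the same
    hypothesis.  As the first and second moments of the reversed law are
    combinations of iterated partial sums of [f], divided by the partial sums,
    the mean tends to [L] and the variance to [L ^ 2 - L]; reversal preserves
    the variance.  Finally [c_1, c_2 >= 1] gives [x + x ^ 2 <= 1], i.e.
    [x <= phi - 1], with equality in the Fibonacci case. *)

Require Import Defs.
From mathcomp Require Import all_boot all_order all_algebra.
From mathcomp Require Import all_classical all_reals all_analysis.
From mathcomp Require Import measurable_realfun.
From mathcomp Require Import lra zify ring.

Import Order.TTheory GRing.Theory Num.Theory.
Import numFieldNormedType.Exports.

Local Open Scope classical_set_scope.
Local Open Scope ring_scope.

(** * Oscillation of sequences satisfying an averaging recurrence *)

Definition averaging (R : realType) (k : nat) (p g : nat -> R) : Prop :=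
  forall n, (k < n)%N -> g n = \sum_(1 <= i < k.+1) p i * g (n - i)%N.

Lemma averagingN (R : realType) k (p g : nat -> R) :
  averaging R k p g -> averaging R k p (fun n => - g n).
Proof.
move=> gE n kn; rewrite gE// -sumrN.
by apply: eq_bigr => i _; rewrite mulrN.
Qed.

(** As the weights sum to 1, the excess of [g n] over [m] is the same average of earlier excesses;
    all of them are nonnegative and only the term [i = 1] is kept. *)
Lemma averaging_ge (R : realType) k (p g : nat -> R) n m :
  (0 < k)%N -> (forall i, (1 <= i <= k)%N -> 0 <= p i) ->
  \sum_(1 <= i < k.+1) p i = 1 -> averaging R k p g -> (k < n)%N ->
  (forall j, (n <= j + k)%N -> (j < n)%N -> m <= g j) ->
  m + p 1%N * (g n.-1 - m) <= g n.
Proof.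
move=> k0 p0 p1 gE kn mg.
have -> : g n = m + \sum_(1 <= i < k.+1) p i * (g (n - i)%N - m).
  under eq_bigr do rewrite mulrBr.
  by rewrite sumrB -mulr_suml p1 mul1r -gE// addrC subrK.
rewrite lerD2l big_ltn// subn1 lerDl big_seq_cond sumr_ge0// => i.
rewrite andbT mem_index_iota => ik.
rewrite mulr_ge0 ?p0 ?subr_ge0 ?mg//; lia.
Qed.

Lemma averaging_ge_tail (R : realType) k (p g : nat -> R) n0 m :
  (0 < k)%N -> (forall i, (1 <= i <= k)%N -> 0 <= p i) ->
  \sum_(1 <= i < k.+1) p i = 1 -> averaging R k p g ->
  (forall j, (n0 < j <= n0 + k)%N -> m <= g j) ->
  forall j, (n0 < j)%N -> m <= g j.
Proof.
move=> k0 p0 p1 gE mg; elim/ltn_ind => j ih n0j.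
have [jk|jk] := leqP j (n0 + k)%N; first by apply: mg; rewrite n0j.
have mj i : (j <= i + k)%N -> (i < j)%N -> m <= g i.
  by move=> ji ij; apply: ih => //; lia.
apply: le_trans (averaging_ge R k p g j m k0 p0 p1 gE _ mj); last lia.
rewrite lerDl mulr_ge0 ?p0 ?subr_ge0 ?mj//; lia.
Qed.

(* Each new term retains at least a fraction [p 1] of the excess over [m] of its
   predecessor, and [p 1 ^+ k] is the worst fraction in the window of [k] terms
   that follows [g (n0 + k)]. *)
Lemma averaging_ge_step (R : realType) k (p g : nat -> R) n0 m :
  (0 < k)%N -> (forall i, (1 <= i <= k)%N -> 0 <= p i) -> p 1%N <= 1 ->
  \sum_(1 <= i < k.+1) p i = 1 -> averaging R k p g ->
  (forall j, (n0 < j)%N -> m <= g j) ->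
  forall j, (n0 + k < j)%N -> m + p 1%N ^+ k * (g (n0 + k)%N - m) <= g j.
Proof.
move=> k0 p0 p1le p1 gE mg.
have p10 : 0 <= p 1%N by apply: p0; lia.
have a0 : 0 <= g (n0 + k)%N - m by rewrite subr_ge0 mg//; lia.
have H t : m + p 1%N ^+ t * (g (n0 + k)%N - m) <= g (n0 + k + t)%N.
  elim: t => [|t ih]; first by rewrite expr0 mul1r addn0 addrC subrK.
  apply: le_trans (averaging_ge R k p g _ m k0 p0 p1 gE _ _); last 2 first.
  - lia.
  - by move=> j h1 h2; apply: mg; lia.
  rewrite addnS/= lerD2l exprS -mulrA ler_wpM2l//.
  by rewrite lerBrDr addrC.
apply: (averaging_ge_tail R k p g _ _ k0 p0 p1 gE) => j jk.
have -> : j = (n0 + k + (j - (n0 + k)))%N by lia.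
apply: le_trans (H _); rewrite lerD2l ler_wpM2r//.
by apply: ler_wiXn2l => //; lia.
Qed.

(** With [a] the last term of a window and [P = p 1 ^+ k], the one-sided step for [g] raises [m] by
    [P * (a - m)], and for [- g] it lowers [M] by [P * (M - a)]. The gains add up to [P * (M - m)],
    whatever [a] is. The conjunct [m0 <= m] keeps a fixed positive floor for later divisions. *)
Lemma averaging_osc (R : realType) k (p g : nat -> R) m0 M0 :
  (0 < k)%N -> (forall i, (1 <= i <= k)%N -> 0 <= p i) -> p 1%N <= 1 ->
  \sum_(1 <= i < k.+1) p i = 1 -> averaging R k p g ->
  (forall j, (0 < j <= k)%N -> m0 <= g j <= M0) ->
  forall t, exists m M, [/\ m0 <= m,
    (forall j, (t * k < j)%N -> m <= g j <= M) &
    M - m = (1 - p 1%N ^+ k) ^+ t * (M0 - m0)].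
Proof.
move=> k0 p0 p1le p1 gE b0; have gNE := averagingN _ _ _ _ gE.
elim=> [|t [m [M [mm0 b MmE]]]].
  exists m0, M0; rewrite lexx expr0 mul1r; split => // j; rewrite mul0n => j0.
  rewrite (averaging_ge_tail R k p g 0 m0)//=; last first.
    by move=> i; rewrite add0n => /b0/andP[].
  rewrite -lerN2 (averaging_ge_tail R k p _ 0 (- M0) k0 p0 p1 gNE)//=.
  by move=> i; rewrite add0n lerN2 => /b0/andP[].
set a := g (t * k + k)%N; set P := p 1%N ^+ k.
have /andP[ma aM] : m <= a <= M by apply: b; lia.
exists (m + P * (a - m)), (M - P * (M - a)); split.
- rewrite (le_trans mm0)// lerDl mulr_ge0 ?subr_ge0// exprn_ge0// p0//; lia.
- move=> j; rewrite mulSn addnC => jk.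
  rewrite (averaging_ge_step R k p g (t * k) m)//=; last by move=> i /b/andP[].
  rewrite -lerN2.
  have -> : - (M - P * (M - a)) = - M + P * (- a - - M) by ring.
  apply: (averaging_ge_step R k p _ (t * k) (- M) k0 p0 p1le p1 gNE) => //.
  by move=> i /b/andP[_]; rewrite lerN2.
- by rewrite exprS -mulrA -MmE -/P; ring.
Qed.

Lemma averaging_ratio_cvg (R : realType) k (p g : nat -> R) m0 M0 :
  (0 < k)%N -> (forall i, (1 <= i <= k)%N -> 0 <= p i) -> 0 < p 1%N <= 1 ->
  \sum_(1 <= i < k.+1) p i = 1 -> averaging R k p g -> 0 < m0 ->
  (forall j, (0 < j <= k)%N -> m0 <= g j <= M0) ->
  g n / g n.+1 @[n --> \oo] --> (1 : R).
Proof.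
move=> k0 p0 /andP[p1gt0 p1le] p1 gE m00 b0.
have osc := averaging_osc R k p g m0 M0 k0 p0 p1le p1 gE b0.
apply/cvgrPdist_le => /= e e0.
set q := 1 - p 1%N ^+ k.
have q0 : 0 <= q by rewrite subr_ge0 exprn_ile1// ltW.
have : q ^+ n * (M0 - m0) @[n --> \oo] --> (0 * (M0 - m0) : R).
  apply: cvgMl; apply: cvg_expr; rewrite ger0_norm// /q ltrBlDr ltrDl.
  by rewrite exprn_gt0.
(* The tolerance is [e * m0] because the difference of consecutive terms gets divided by
   [g n.+1 >= m0]; the limit of [g] itself is never identified. *)
rewrite mul0r => /cvgrPdist_le/(_ _ (mulr_gt0 e0 m00))[t _ /(_ t (leqnn _))].
have [m [M [mm0 b MmE]]] := osc t.
rewrite /= sub0r normrN -/q -MmE => hM.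
exists (t * k).+1 => // n /= tn.
have /andP[m1 M1] : m <= g n <= M by apply: b; lia.
have /andP[m2 M2] : m <= g n.+1 <= M by apply: b; lia.
have g0 : 0 < g n.+1 by lra.
have -> : 1 - g n / g n.+1 = (g n.+1 - g n) / g n.+1.
  by rewrite mulrBl divff// gt_eqF.
rewrite normf_div (gtr0_norm g0) ler_pdivrMr//.
apply: (@le_trans _ _ (e * m0)).
  apply: le_trans hM; rewrite (@ger0_norm _ (M - m)); last by lra.
  by rewrite ler_norml; lra.
by rewrite ler_pM2l//; lra.
Qed.

(** * Perturbed contractions and ratios of partial sums *)

Lemma perturbed_contraction_cvg0 (R : realType) (e d q : nat -> R) (q0 : R) :
  0 <= q0 < 1 -> q n @[n --> \oo] --> q0 -> d n @[n --> \oo] --> (0 : R) ->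
  (forall n, `|e n.+1| <= q n * `|e n| + d n) -> e n @[n --> \oo] --> (0 : R).
Proof.
move=> /andP[q00 q01] cq cd he; apply/cvgrPdist_le => /= eps eps0.
(* The midpoint [r] of [q0] and 1 eventually bounds [q n], and [d n] is eventually at most
   [eps / 2 * (1 - r)], which makes [eps / 2] the fixed point of the dominating affine map. *)
pose r := (q0 + 1) / 2; have r01 : 0 <= r < 1 by rewrite /r; lra.
have eta0 : 0 < eps / 2 * (1 - r) by rewrite mulr_gt0//; lra.
have qr : 0 < (1 - q0) / 2 by lra.
move/cvgrPdist_le : cq => /(_ _ qr)[N1 _ /= HN1].
move/cvgrPdist_le : cd => /(_ _ eta0)[N2 _ /= HN2].
have [N [N1N N2N]] : exists N, (N1 <= N /\ N2 <= N)%N.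
  by exists (maxn N1 N2); lia.
have H t : `|e (N + t)%N| <= r ^+ t * `|e N| + eps / 2.
  elim: t => [|t ih]; first by rewrite addn0 expr0 mul1r lerDl; lra.
  rewrite addnS; apply: le_trans (he _) _.
  have := HN1 (N + t)%N (leq_trans N1N (leq_addr _ _)).
  rewrite ler_norml => /andP[].
  rewrite lerBrDr -lerBrDl opprK => q1 _.
  have := HN2 (N + t)%N (leq_trans N2N (leq_addr _ _)).
  rewrite sub0r normrN => /(le_trans (ler_norm _)) d1.
  have q2 : q (N + t)%N <= r by rewrite /r; lra.
  apply: le_trans (lerD (ler_wpM2r (normr_ge0 _) q2) d1) _.
  have /andP[r0 _] := r01.
  apply: le_trans (lerD (ler_wpM2l r0 ih) (lexx _)) _.
  by rewrite le_eqVlt; apply/orP; left; apply/eqP; rewrite exprS; field.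
have : r ^+ t * `|e N| @[t --> \oo] --> (0 * `|e N| : R).
  by apply: cvgMl; apply: cvg_expr; rewrite ger0_norm; lra.
have eps2 : 0 < eps / 2 by lra.
rewrite mul0r => /cvgrPdist_le/(_ _ eps2)[N3 _ /= HN3].
exists (N + N3)%N => // n /= hn.
rewrite sub0r normrN; have -> : n = (N + (n - N))%N by lia.
apply: le_trans (H _) _.
have N3n : (N3 <= n - N)%N by lia.
have := HN3 _ N3n; rewrite sub0r normrN => /(le_trans (ler_norm _)) h.
by rewrite [leRHS]splitr lerD2r.
Qed.

(** The limit [l] is the fixed point of [l = 1 + q0 * l], and the error obeys [r n.+1 - l = q n * (r
    n - l) + (q n - q0) * l], a contraction with vanishing perturbation. *)
Lemma affine_recursion_cvg (R : realType) (r q : nat -> R) (q0 : R) :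
  0 <= q0 < 1 -> q n @[n --> \oo] --> q0 -> (forall n, 0 <= q n) ->
  (forall n, r n.+1 = 1 + q n * r n) -> r n @[n --> \oo] --> (1 - q0)^-1.
Proof.
move=> q01 cq qge0 rE; set l := (1 - q0)^-1.
have lE : l = 1 + q0 * l by rewrite /l; field; rewrite gt_eqF//; lra.
rewrite -[l]add0r; apply/subr_cvg0 => /=; rewrite add0r.
apply: (perturbed_contraction_cvg0 R _
  (fun n => `|q n - q0| * `|l|) q q0) => //.
  rewrite -(mul0r `|l|) -(normr0 R) -(subrr q0).
  by apply: cvgMl; apply: cvg_norm; apply: cvgB => //; exact: cvg_cst.
move=> n; rewrite rE [in leLHS]lE -normrM.
rewrite -[X in X * `|_| + _]ger0_norm// -normrM.
by apply: le_trans (ler_normD _ _); rewrite le_eqVlt; apply/orP; left;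
  apply/eqP; congr `|_|; ring.
Qed.

Definition psum (R : realType) (u : nat -> R) (N : nat) : R :=
  \sum_(1 <= j < N.+1) u j.

Lemma psumS (R : realType) (u : nat -> R) N :
  psum R u N.+1 = psum R u N + u N.+1.
Proof. by rewrite /psum big_nat_recr. Qed.

Lemma psum_gt0 (R : realType) (u : nat -> R) :
  (forall n, (0 < n)%N -> 0 < u n) -> forall n, (0 < n)%N -> 0 < psum R u n.
Proof.
move=> u0 [//|n _]; rewrite psumS ltr_wpDl ?u0// /psum big_seq_cond.
rewrite sumr_ge0// => i; rewrite andbT mem_index_iota => /andP[i0 _].
by rewrite ltW// u0.
Qed.

Lemma psum_div_cvg (R : realType) (u : nat -> R) (q : R) :
  0 < q < 1 -> (forall n, (0 < n)%N -> 0 < u n) ->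
  u n / u n.+1 @[n --> \oo] --> q ->
  psum R u n / u n @[n --> \oo] --> (1 - q)^-1.
Proof.
(* The shift avoids [u 0], about which nothing is known. The quotient at [n.+2] is 1 plus
   [u n.+1 / u n.+2] times the quotient at [n.+1]. *)
move=> q01 u0 uq; rewrite -cvg_shiftS /=.
apply: (affine_recursion_cvg R _ (fun n => u n.+1 / u n.+2) q).
- by lra.
- by rewrite (cvg_shiftS (fun n => u n / u n.+1)).
- by move=> n; rewrite divr_ge0// ltW// u0.
- move=> n; rewrite psumS addrC mulrDl divff ?gt_eqF ?u0//; congr (_ + _).
  by field; rewrite !gt_eqF ?u0.
Qed.

(** The ratio is [(psum n / u n) * (u n / u n.+1) / (psum n.+1 / u n.+1)], whose outer factors have
    the same nonzero limit and cancel. This lets partial summation be iterated. *)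
Lemma psum_ratio_cvg (R : realType) (u : nat -> R) (q : R) :
  0 < q < 1 -> (forall n, (0 < n)%N -> 0 < u n) ->
  u n / u n.+1 @[n --> \oo] --> q ->
  psum R u n / psum R u n.+1 @[n --> \oo] --> q.
Proof.
move=> q01 u0 uq; have h := psum_div_cvg R u q q01 u0 uq.
have l0 : (1 - q)^-1 != 0 by rewrite invr_eq0 gt_eqF//; lra.
have h1 : psum R u n.+1 / u n.+1 @[n --> \oo] --> (1 - q)^-1.
  by rewrite (cvg_shiftS (fun n => psum R u n / u n)).
have -> : q = (1 - q)^-1 * q / (1 - q)^-1 by rewrite mulrAC divff// mul1r.
apply: cvg_trans (cvgM (cvgM h uq) (cvgV l0 h1)).
apply: near_eq_cvg; near=> n => /=.
have n0 : (0 < n)%N by near: n; exact: nbhs_infty_gt.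
have a := u0 n n0; have b := u0 n.+1 isT.
have c := psum_gt0 R u u0 n.+1 isT.
by field; rewrite !gt_eqF.
Unshelve. all: by end_near. Qed.

(** * The recurrence and its characteristic root *)

Lemma recurrence_gt0 k c f : positive_linear_recurrence k c f ->
  forall n, (0 < n)%N -> (0 < f n)%N.
Proof.
move=> [k2 c0 f0 fE]; elim/ltn_ind => n ih n0.
have [nk|kn] := leqP n k; first by rewrite f0// n0.
rewrite fE// big_ltn; last lia.
by rewrite ltn_addr// muln_gt0 c0 ?ih//; lia.
Qed.

Lemma recurrence_ratio_cvg (R : realType) k c f (x : R) :
  positive_linear_recurrence k c f -> 0 < x < 1 ->
  \sum_(1 <= i < k.+1) (c i)%:R * x ^+ i = 1 ->
  (f n)%:R / (f n.+1)%:R @[n --> \oo] --> x.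
Proof.
move=> H /andP[x0 x1] hx; have fp := recurrence_gt0 _ _ _ H.
have [k2 c0 f0 fE] := H.
pose p i : R := (c i)%:R * x ^+ i; pose g n : R := (f n)%:R * x ^+ n.
have p0 i : (1 <= i <= k)%N -> 0 <= p i.
  by move=> _; rewrite mulr_ge0// exprn_ge0// ltW.
have p1 : 0 < p 1%N <= 1.
  rewrite mulr_gt0 ?ltr0n ?c0 ?exprn_gt0//=; last lia.
  rewrite -hx big_ltn; last lia.
  rewrite lerDl big_seq_cond sumr_ge0// => i.
  rewrite andbT mem_index_iota => ik.
  by apply: p0; lia.
have gE : averaging R k p g.
  move=> n kn; rewrite {1}/g fE// natr_sum mulr_suml.
  rewrite big_seq_cond [RHS]big_seq_cond; apply: eq_bigr => i.
  rewrite andbT mem_index_iota => ik.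
  rewrite natrM /p /g mulrACA -exprD subnKC//; lia.
(* Crude bounds on the initial window: [f j >= 1] and [x ^+ j >= x ^+ k] below, the sum of all the
   terms of the window above. *)
have b0 j : (0 < j <= k)%N -> x ^+ k <= g j <= \sum_(1 <= i < k.+1) g i.
  move=> /andP[j0 jk]; apply/andP; split.
    apply: (@le_trans _ _ (x ^+ j)).
      by apply: ler_wiXn2l => //; rewrite ltW.
    by rewrite /g ler_peMl ?exprn_ge0 ?ler1n ?fp// ltW.
  rewrite (@big_rem _ _ _ _ _ j)/=; last by rewrite mem_index_iota; lia.
  by rewrite lerDl sumr_ge0// => i _; rewrite mulr_ge0// exprn_ge0// ltW.
have k0 : (0 < k)%N by lia.
have g1 := averaging_ratio_cvg R k p g _ _ k0 p0 p1 hx gE (exprn_gt0 k x0) b0.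
have : g n / g n.+1 * x @[n --> \oo] --> 1 * x by apply: cvgMl; exact: g1.
rewrite mul1r; apply: cvg_trans.
apply: near_eq_cvg; near=> n => /=.
have a : (f n.+1)%:R != 0 :> R by rewrite pnatr_eq0 -lt0n fp.
have b : x ^+ n != 0 by rewrite expf_neq0// gt_eqF.
rewrite /g exprSr; field.
by rewrite a b gt_eqF.
Unshelve. all: by end_near. Qed.

(** The intermediate value theorem applies on [0, 1]: the polynomial is -1 at 0, and [c 1, c 2 >= 1]
    makes it at least 1 at 1. The same lower bound [x + x ^+ 2] taken at the root gives the
    inequality, which also forces [x < 1]. *)
Lemma char_root (R : realType) k (c : nat -> nat) : (2 <= k)%N ->
  (forall i, (1 <= i <= k)%N -> (0 < c i)%N) ->
  exists x : R, [/\ 0 < x < 1, x + x ^+ 2 <= 1 &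
    \sum_(1 <= i < k.+1) (c i)%:R * x ^+ i = 1].
Proof.
move=> k2 c0.
pose p : {poly R} := \sum_(1 <= i < k.+1) (c i)%:R *: 'X^i - 1.
have pE x : p.[x] = \sum_(1 <= i < k.+1) (c i)%:R * x ^+ i - 1.
  rewrite /p hornerD hornerN hornerE horner_sum; congr (_ - _).
  by apply: eq_bigr => i _; rewrite hornerZ hornerXn.
have sum2 (x : R) : 0 <= x ->
    x + x ^+ 2 <= \sum_(1 <= i < k.+1) (c i)%:R * x ^+ i.
  move=> x0; rewrite big_ltn 1?big_ltn; [|lia|lia].
  rewrite addrA -[leLHS]addr0 lerD//; last first.
    by rewrite sumr_ge0// => i _; rewrite mulr_ge0// exprn_ge0.
  by rewrite lerD// ler_peMl ?exprn_ge0// ler1n c0//; lia.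
have s0 : \sum_(1 <= i < k.+1) (c i)%:R * 0 ^+ i = 0 :> R.
  rewrite big_seq_cond big1// => i; rewrite andbT mem_index_iota => ik.
  by rewrite expr0n; case: i ik => // i _; rewrite mulr0.
have h01 : p.[0] <= 0 <= p.[1].
  rewrite !pE s0 sub0r oppr_le0 ler01/= subr_ge0.
  by apply: le_trans (sum2 1 ler01); rewrite expr1n lerDl.
have [x /andP[x0 x1] /rootP] := poly_ivt ler01 h01.
rewrite pE => /eqP; rewrite subr_eq0 => /eqP xE.
have h := sum2 x x0; rewrite xE in h.
have xn0 : x != 0.
  apply/eqP => x00; move: xE; rewrite x00 s0 => /eqP.
  by rewrite eq_sym oner_eq0.
exists x; split => //; have : 0 < x by rewrite lt0r xn0.
by move=> x00; rewrite x00/=; have := exprn_gt0 2 x00; lra.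
Qed.

(** * Moments of a law on {1, ..., N} *)

Lemma law_expectation (R : realType) N (p : nat -> R) (X : real_rv R)
    (h : R -> R) (Y : rv_space X -> R) :
  has_law_upto N p X -> (forall n : nat, 0 <= h n%:R) ->
  (forall w, Y w = h (rv_fun X w)) ->
  ('E_(rv_prob X)[Y])%E = (\sum_(1 <= n < N.+1) h n%:R * p n)%:E.
Proof.
move=> [Xr Xp] h0 YE; rewrite unlock.
pose A (n : nat) := rv_fun X @^-1` [set n%:R].
have mA n : measurable (A n).
  by rewrite -[A n]setTI; apply: measurable_funP => //; exact: measurable_set1.
(* Every value of the variable lies in {1, ..., N}, so [Y] is pointwise a finite combination of
   indicators of level sets. Nonnegativity of [h] then lets sum and integral be exchanged without an
   integrability argument. *)
have -> : (\int[rv_prob X]_w (Y w)%:E = \int[rv_prob X]_w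
    \sum_(n <- index_iota 1 N.+1) (h n%:R * \1_(A n) w)%:E)%E.
  apply: eq_integral => w _; rewrite YE.
  have [n nN Xn] := Xr w.
  have nI : n \in index_iota 1 N.+1 by rewrite mem_index_iota; lia.
  rewrite sumEFin (bigD1_seq n)//= ?iota_uniq// Xn.
  rewrite indicE mem_set ?mulr1; last by rewrite /A /= Xn.
  rewrite big1 ?addr0// => m mn; rewrite indicE memNset ?mulr0//.
  rewrite /A /= Xn => /eqP; rewrite eqr_nat => /eqP nm.
  by rewrite nm eqxx in mn.
rewrite ge0_integral_sum//; last 2 first.
- move=> n; apply/measurable_EFinP; apply: measurable_funM.
    exact: measurable_cst.
  by apply: measurable_realfun.measurable_indic.
- by move=> n w _; rewrite lee_fin mulr_ge0.
rewrite -sumEFin big_seq [RHS]big_seq; apply: eq_bigr => n.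
rewrite mem_index_iota => nN.
rewrite (@integralZl_indic _ _ _ _ _ _ (fun _ => A n))//; last first.
  by rewrite ltNge h0.
by rewrite integral_indic// setIT EFinM; congr (_ * _)%E; exact: Xp.
Qed.

Definition pmean (R : realType) N (p : nat -> R) : R :=
  \sum_(1 <= n < N.+1) n%:R * p n.

Definition pvar (R : realType) N (p : nat -> R) : R :=
  \sum_(1 <= n < N.+1) (n%:R - pmean R N p) ^+ 2 * p n.

(** The total mass is read off from the expectation of the constant 1. *)
Lemma law_sum1 (R : realType) N (p : nat -> R) (X : real_rv R) :
  has_law_upto N p X -> \sum_(1 <= n < N.+1) p n = 1.
Proof.
move=> Xp.
have := law_expectation R N p X (cst 1) (cst 1) Xp (fun=> ler01) (fun=> erefl).
rewrite expectation_cst => -[->].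
by apply: eq_bigr => i _; rewrite mul1r.
Qed.

Lemma expect_law (R : realType) N (p : nat -> R) (X : real_rv R) :
  has_law_upto N p X -> expect X = (pmean R N p)%:E.
Proof.
by move=> Xp; rewrite /expect (law_expectation R N p X id _ Xp).
Qed.

Lemma var_law (R : realType) N (p : nat -> R) (X : real_rv R) :
  has_law_upto N p X -> var X = (pvar R N p)%:E.
Proof.
move=> Xp; rewrite /var /variance unlock.
have := expect_law R N p X Xp; rewrite /expect => -> /=.
rewrite (law_expectation R N p X (fun x => (x - pmean R N p) ^+ 2) _ Xp)//.
by move=> n; rewrite sqr_ge0.
Qed.

Lemma pvarE (R : realType) N (p : nat -> R) :
  \sum_(1 <= n < N.+1) p n = 1 ->
  pvar R N p = \sum_(1 <= n < N.+1) n%:R ^+ 2 * p n - pmean R N p ^+ 2.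
Proof.
move=> p1; rewrite /pvar; set m := pmean R N p.
rewrite (eq_bigr (fun n => n%:R ^+ 2 * p n - 2 * m * (n%:R * p n) +
  m ^+ 2 * p n)); last by move=> n _; ring.
rewrite big_split/= sumrB -!mulr_sumr p1 -/(pmean R N p) -/m; ring.
Qed.

(** The reflection [n -> N + 1 - n] sends the mean to [N + 1] minus the mean, so each deviation only
    changes sign. *)
Lemma pvar_rev (R : realType) N (p p' : nat -> R) :
  \sum_(1 <= n < N.+1) p n = 1 ->
  (forall n, (1 <= n <= N)%N -> p' n = p (N.+1 - n)%N) ->
  pvar R N p' = pvar R N p.
Proof.
move=> p1 pE.
have rev (F : nat -> R) : \sum_(1 <= n < N.+1) F n * p' n =
    \sum_(1 <= n < N.+1) F (N.+1 - n)%N * p n.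
  rewrite big_nat_rev/= big_seq [RHS]big_seq; apply: eq_bigr => i.
  rewrite mem_index_iota => iN; rewrite add1n subSS pE; last lia.
  by congr (F _ * p _); lia.
have mE : pmean R N p' = N.+1%:R - pmean R N p.
  have -> : N.+1%:R = \sum_(1 <= n < N.+1) N.+1%:R * p n.
    by rewrite -mulr_sumr p1 mulr1.
  rewrite /pmean rev -sumrB.
  rewrite big_seq [RHS]big_seq; apply: eq_bigr => i.
  by rewrite mem_index_iota => iN; rewrite natrB ?mulrBl//; lia.
rewrite /pvar (rev (fun n => (n%:R - pmean R N p') ^+ 2)) mE.
rewrite big_seq [RHS]big_seq; apply: eq_bigr => i.
rewrite mem_index_iota => iN; rewrite natrB; last lia.
by congr (_ * _); ring.
Qed.

(** * Moments of the reversed law as iterated partial sums *)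

Lemma convS (R : realType) (w u : nat -> R) N :
  \sum_(1 <= n < N.+2) w n * u (N.+2 - n)%N =
  w 1%N * u N.+1 + \sum_(1 <= n < N.+1) w n.+1 * u (N.+1 - n)%N.
Proof.
rewrite big_ltn// subSS subn0; congr (_ + _).
by rewrite big_add1.
Qed.

Lemma conv1 (R : realType) (u : nat -> R) N :
  \sum_(1 <= n < N.+1) u (N.+1 - n)%N = psum R u N.
Proof.
rewrite /psum big_nat_rev/= big_seq [RHS]big_seq; apply: eq_bigr => i.
by rewrite mem_index_iota => iN; congr u; lia.
Qed.

(** The term [u j] occurs in the partial sums of index [j, ..., N], that is [N + 1 - j] times. *)
Lemma conv_id (R : realType) (u : nat -> R) N :
  \sum_(1 <= n < N.+1) n%:R * u (N.+1 - n)%N = psum R (psum R u) N.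
Proof.
elim: N => [|N ih]; first by rewrite /psum !big_geq.
rewrite (convS R (fun n => n%:R)) mul1r.
under eq_bigr do rewrite mulrSr mulrDl mul1r.
by rewrite big_split/= ih conv1 [RHS]psumS psumS; ring.
Qed.

(** Write [n ^ 2 = 2 * (n * (n + 1) / 2) - n]: the triangular numbers are the weights of the triple
    partial sum. *)
Lemma conv_sqr (R : realType) (u : nat -> R) N :
  \sum_(1 <= n < N.+1) n%:R ^+ 2 * u (N.+1 - n)%N =
  2 * psum R (psum R (psum R u)) N - psum R (psum R u) N.
Proof.
elim: N => [|N ih]; first by rewrite /psum !big_geq// mulr0 subr0.
rewrite (convS R (fun n => n%:R ^+ 2)) expr1n mul1r.
rewrite (eq_bigr (fun n => n%:R ^+ 2 * u (N.+1 - n)%N +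
  2 * (n%:R * u (N.+1 - n)%N) + u (N.+1 - n)%N)); last first.
  by move=> n _; rewrite mulrSr; ring.
rewrite !big_split/= -mulr_sumr ih conv1 conv_id.
by rewrite !(psumS _ (psum _ _)) psumS; ring.
Qed.

Lemma cvg_EFin_near (R : realType) (T : nat -> \bar R) (r : nat -> R) (l : R) :
  (forall N, (0 < N)%N -> T N = (r N)%:E) -> r N @[N --> \oo] --> l ->
  T N @[N --> \oo] --> l%:E.
Proof.
move=> Tr rl; apply: (@cvg_trans _ ((r N)%:E @[N --> \oo])).
  apply: near_eq_cvg; near=> N; rewrite Tr//.
  by near: N; exact: nbhs_infty_gt.
by apply: cvg_EFin; [exact: nearW|exact: rl].
Unshelve. all: by end_near. Qed.

Lemma underline_limits (R : realType) (u : nat -> R) (x : R) :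
  0 < x < 1 -> (forall n, (0 < n)%N -> 0 < u n) ->
  u n / u n.+1 @[n --> \oo] --> x ->
  let p N n := u (N.+1 - n)%N / psum R u N in
  pmean R N (p N) @[N --> \oo] --> (1 - x)^-1 /\
  pvar R N (p N) @[N --> \oo] --> (1 - x)^-1 ^+ 2 - (1 - x)^-1.
Proof.
move=> x01 u0 ux p; set L := (1 - x)^-1.
have u1 := psum_gt0 R u u0; have u2 := psum_gt0 R _ u1.
have r1 := psum_ratio_cvg R u x x01 u0 ux.
have r2 := psum_ratio_cvg R _ x x01 u1 r1.
have c1 := psum_div_cvg R _ x x01 u1 r1.
have c2 := psum_div_cvg R _ x x01 u2 r2.
have mE N : pmean R N (p N) = psum R (psum R u) N / psum R u N.
  by rewrite -conv_id mulr_suml; apply: eq_bigr => i _; rewrite mulrA.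
split; first by under eq_fun do rewrite mE.
(* With [A], [B], [C] the successive partial sums, the mean is [B / A] and the second moment
   [(2 * C - B) / A]; [C / A] is split as [(C / B) * (B / A)], each factor tending to [L]. *)
have -> : L ^+ 2 - L = 2 * (L * L) - L - L * L by ring.
pose A := psum R u; pose B := psum R A; pose C := psum R B.
have : 2 * (C N / B N * (B N / A N)) - B N / A N - B N / A N * (B N / A N)
    @[N --> \oo] --> 2 * (L * L) - L - L * L.
  by apply: (cvgB _ (cvgM c1 c1)); apply: (cvgB _ c1); apply: cvgMr;
    exact: (cvgM c2 c1).
apply: cvg_trans; apply: near_eq_cvg; near=> N => /=.
have N0 : (0 < N)%N by near: N; exact: nbhs_infty_gt.
have a := u1 N N0; have b := u2 N N0.
rewrite pvarE; last by rewrite -mulr_suml conv1 divff// gt_eqF.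
rewrite /A /B /C; under [in RHS]eq_bigr do rewrite mulrA.
rewrite -mulr_suml conv_sqr mE; field.
by rewrite !gt_eqF.
Unshelve. all: by end_near. Qed.

(** * Existence of variables with the prescribed laws *)

Lemma real_rv_exists (R : realType) N (p : nat -> R) :
  (0 < N)%N -> (forall n, 0 <= p n) -> \sum_(1 <= n < N.+1) p n = 1 ->
  exists X : real_rv R, has_law_upto N p X.
Proof.
move=> N0 p0 p1.
pose mu : {measure set nat -> \bar R} :=
  msum (fun i => mscale (NngNum (p0 i.+1)) (@dirac _ nat i.+1 R)) N.
have muE (A : set nat) : mu A = (\sum_(1 <= n < N.+1) p n * \1_A n)%:E.
  rewrite /mu /= /msum big_add1 big_mkord -sumEFin.
  by apply: eq_bigr => i _; rewrite EFinM.
(* Since [mu] has mass 1, normalizing leaves it unchanged and only supplies the probability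
   structure; the Dirac mass is the default for degenerate measures. *)
pose P : probability nat R := mnormalize mu (@dirac _ nat 1%N R).
have PE A : P A = mu A.
  have mu1 : mu setT = 1%E.
    rewrite muE -p1; congr _%:E.
    by apply: eq_bigr => i _; rewrite indicE in_setT mulr1.
  by rewrite /P /= /mnormalize mu1 onee_eq0/= invr1 mule1.
(* The range condition holds at every point, not just almost surely, so integers outside {1, ...,
   N}, of mass 0, are sent to 1. *)
pose clamp n := if (1 <= n <= N)%N then n else 1%N.
pose g (n : nat) : R := (clamp n)%:R.
have mg : g \in @mfun _ _ nat R by rewrite inE.
exists (@RealRV R _ nat P (mfun_Sub mg)); split => [w|n nN] /=.
  exists (clamp w) => //; rewrite /clamp; case: ifP => //; lia.
rewrite PE muE; congr _%:E.
rewrite (bigD1_seq n)/= ?iota_uniq ?mem_index_iota//.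
rewrite indicE mem_set ?mulr1; last by rewrite /= /g /clamp nN.
rewrite big_seq_cond big1 ?addr0// => m; rewrite mem_index_iota => /andP[mN mn].
rewrite indicE memNset ?mulr0// /= /g /clamp.
have -> : (1 <= m <= N)%N by lia.
by move/eqP; rewrite eqr_nat (negbTE mn).
Qed.

Lemma bar_law_exists (R : realType) (f : nat -> nat) :
  (forall n, (0 < n)%N -> (0 < f n)%N) ->
  exists X : nat -> real_rv R, bar_law f X.
Proof.
move=> f0; pose p N n : R := (f n)%:R / (\sum_(1 <= j < N.+1) f j)%N%:R.
(* There is no law on an empty range: variables are chosen for [N.+1] and reindexed by the
   predecessor. *)
have H N : exists X : real_rv R, has_law_upto N.+1 (p N.+1) X.
  apply: real_rv_exists => // [n|]; first by rewrite divr_ge0.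
  rewrite -mulr_suml -natr_sum divff// pnatr_eq0 -lt0n.
  by rewrite big_ltn// addn_gt0 f0.
have [X HX] := choice H.
by exists (fun N => X N.-1); case=> // N _; exact: HX.
Qed.

Lemma underline_law_exists (R : realType) (f : nat -> nat) :
  (forall n, (0 < n)%N -> (0 < f n)%N) ->
  exists X : nat -> real_rv R, underline_law f X.
Proof.
move=> f0.
pose p N n : R := (f (N + 1 - n)%N)%:R / (\sum_(1 <= j < N.+1) f j)%N%:R.
have H N : exists X : real_rv R, has_law_upto N.+1 (p N.+1) X.
  apply: real_rv_exists => // [n|]; first by rewrite divr_ge0.
  rewrite -mulr_suml -natr_sum addn1 (_ : (\sum_(1 <= i < _) _)%N =
    (\sum_(1 <= j < N.+2) f j)%N).
    by rewrite divff// pnatr_eq0 -lt0n big_ltn// addn_gt0 f0.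
  by rewrite [RHS]big_nat_rev.
have [X HX] := choice H.
by exists (fun N => X N.-1); case=> // N _; exact: HX.
Qed.

(** * The three limits in terms of the root *)

Lemma recurrence_limits (R : realType) k c f :
  positive_linear_recurrence k c f ->
  exists x : R, [/\ [/\ 0 < x < 1, x + x ^+ 2 <= 1 &
     \sum_(1 <= i < k.+1) (c i)%:R * x ^+ i = 1],
   forall X, underline_law f X -> expect (X N) @[N --> \oo] --> ((1 - x)^-1)%:E,
   forall X, bar_law f X ->
     var (X N) @[N --> \oo] --> ((1 - x)^-1 ^+ 2 - (1 - x)^-1)%:E &
   forall X, underline_law f X ->
     var (X N) @[N --> \oo] --> ((1 - x)^-1 ^+ 2 - (1 - x)^-1)%:E].
Proof.
move=> H; have [k2 c0 _ _] := H.
have [x [x01 x2 hx]] := char_root R k c k2 c0.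
exists x; pose u n : R := (f n)%:R.
have u0 n : (0 < n)%N -> 0 < u n.
  by move=> n0; rewrite ltr0n (recurrence_gt0 _ _ _ H).
have SE N : (\sum_(1 <= j < N.+1) f j)%N%:R = psum R u N by rewrite natr_sum.
have [cm cv] := underline_limits R u x x01 u0
  (recurrence_ratio_cvg R k c f x H x01 hx).
have lawE X : underline_law f X -> forall N, (0 < N)%N ->
    has_law_upto N (fun n => u (N.+1 - n)%N / psum R u N) (X N).
  by move=> hX N N0; have := hX N N0; rewrite SE addn1.
split => // X hX.
- apply: cvg_EFin_near cm => N N0; apply: expect_law; exact: lawE.
(* The limit known for the reversed law carries over, as reversal preserves the variance. *)
- apply: cvg_EFin_near cv => N N0; have h := hX N N0.
  rewrite (var_law R N _ _ h) SE; congr _%:E; apply/esym/pvar_rev => //.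
  by have := law_sum1 R N _ _ h; rewrite SE.
- apply: cvg_EFin_near cv => N N0; apply: var_law; exact: lawE.
Qed.

(** * Extremal values and the golden ratio *)

Lemma golden_bounds (R : realType) (x : R) :
  let phi : R := (1 + Num.sqrt 5) / 2 in
  0 < x < 1 -> x + x ^+ 2 <= 1 ->
  (1 - x)^-1 <= phi + 1 /\ (1 - x)^-1 ^+ 2 - (1 - x)^-1 <= 2 * phi + 1.
Proof.
move=> phi /andP[x0 x1] hx.
have s5 : Num.sqrt 5 ^+ 2 = 5 :> R by rewrite sqr_sqrtr.
have s0 : 0 <= Num.sqrt 5 :> R by rewrite sqrtr_ge0.
have phi2 : phi ^+ 2 = phi + 1 by rewrite /phi; nra.
have phi0 : 0 < phi by rewrite /phi; lra.
(* [phi - 1] is the positive root of [t + t ^ 2 = 1]. Then [1 - x >= 2 - phi], the inverse of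
   [phi + 1], which bounds [L]. As [L ^ 2 - L] increases for [L >= 1], it is at most
   [(phi + 1) * phi = 2 * phi + 1]. *)
have xphi : x <= phi - 1.
  by rewrite leNgt; apply/negP => h; nra.
have x10 : 0 < 1 - x by lra.
set L := (1 - x)^-1.
have Lle : L <= phi + 1.
  by rewrite /L -[_^-1]mul1r ler_pdivrMr//; nra.
have L1 : 1 <= L by rewrite /L invf_ge1//; lra.
split => //; nra.
Qed.

Lemma golden_values (R : realType) (x : R) :
  let phi : R := (1 + Num.sqrt 5) / 2 in
  0 < x -> x + x ^+ 2 = 1 ->
  (1 - x)^-1 = phi + 1 /\ (1 - x)^-1 ^+ 2 - (1 - x)^-1 = 2 * phi + 1.
Proof.
move=> phi x0 hx.
have s5 : Num.sqrt 5 ^+ 2 = 5 :> R by rewrite sqr_sqrtr.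
have s0 : 0 <= Num.sqrt 5 :> R by rewrite sqrtr_ge0.
have phi2 : phi ^+ 2 = phi + 1 by rewrite /phi; nra.
have phi0 : 0 < phi by rewrite /phi; lra.
(* The two roots of [x ^ 2 + x - 1] are [phi - 1] and [- phi]; positivity of [x] excludes the
   second. *)
have : (x - (phi - 1)) * (x + phi) = 0 by nra.
move=> /eqP; rewrite mulf_eq0 => /orP[|/eqP]; last by lra.
rewrite subr_eq0 => /eqP xE.
have -> : (1 - x)^-1 = phi + 1.
  have H : (1 - x) * (phi + 1) = 1 by rewrite xE; nra.
  have x1 : 1 - x != 0.
    apply/eqP => h; move: H; rewrite h mul0r => /eqP.
    by rewrite eq_sym oner_eq0.
  by apply: (mulfI x1); rewrite divff.
by split=> //; nra.
Qed.

Fixpoint fib (n : nat) : nat :=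
  if n is (m.+1 as n').+1 then (fib n' + fib m)%N else n.

Lemma fib_recurrence : positive_linear_recurrence 2 (fun=> 1%N) fib.
Proof.
split=> //; first by case=> [|[|[|]]].
by case=> [|[|[|n]]]// _; rewrite big_ltn// big_nat1 !mul1n.
Qed.

Theorem mainTheorem8 (R : realType) :
  let phi : R := (1 + Num.sqrt 5) / 2 in
  [/\ (* the three limits exist (and are finite) for every choice *)
      forall (k : nat) (c f : nat -> nat) (Xbar Xund : nat -> real_rv R),
        positive_linear_recurrence k c f ->
        bar_law f Xbar -> underline_law f Xund ->
        [/\ exists l : R, expect (Xund N) @[N --> \oo] --> l%:E,
            exists l : R, var (Xbar N) @[N --> \oo] --> l%:E
          & exists l : R, var (Xund N) @[N --> \oo] --> l%:E],
      (* the maxima *)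
      [/\ is_maximum (limit_values (@underline_law R) (@expect R)) (phi + 1),
          is_maximum (limit_values (@bar_law R) (@var R)) (2 * phi + 1)
        & is_maximum (limit_values (@underline_law R) (@var R)) (2 * phi + 1)]
    & (* the Fibonacci recurrence, with any initial values, attains them *)
      forall (c f : nat -> nat) (Xbar Xund : nat -> real_rv R),
        positive_linear_recurrence 2 c f -> c 1%N = 1%N -> c 2%N = 1%N ->
        bar_law f Xbar -> underline_law f Xund ->
        [/\ expect (Xund N) @[N --> \oo] --> (phi + 1)%:E,
            var (Xbar N) @[N --> \oo] --> (2 * phi + 1)%:E
          & var (Xund N) @[N --> \oo] --> (2 * phi + 1)%:E]].
Proof.
move=> phi.
have Hfib (c f : nat -> nat) : positive_linear_recurrence 2 c f ->
    c 1%N = 1%N -> c 2%N = 1%N ->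
  [/\ forall X, underline_law f X ->
        expect (X N) @[N --> \oo] --> (phi + 1)%:E,
      forall X, bar_law f X -> var (X N) @[N --> \oo] --> (2 * phi + 1)%:E &
      forall X, underline_law f X ->
        var (X N) @[N --> \oo] --> (2 * phi + 1)%:E].
  move=> H c1 c2.
  have [x [[/andP[x0 _] _ hx] hE hb hu]] := recurrence_limits R _ _ _ H.
  have x2 : x + x ^+ 2 = 1.
    by rewrite -hx big_ltn// big_nat1 c1 c2 !mul1r expr1.
  have [E1 E2] := golden_values R x x0 x2.
  by rewrite -/phi in E1 E2; rewrite E1 in hE; rewrite E2 in hb hu.
(* A member of [limit_values] is given only as some limit; uniqueness identifies it with the formula
   in [x], to which the golden bounds apply. *)
have unique (T : nat -> \bar R) (l m : R) :
    T N @[N --> \oo] --> l%:E -> T N @[N --> \oo] --> m%:E -> l = m.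
  by move=> hl hm; apply: EFin_inj; exact: (cvg_unique _ hl hm).
have [fE fb fu] := Hfib _ _ fib_recurrence erefl erefl.
have fib0 := recurrence_gt0 _ _ _ fib_recurrence.
have [Xb hXb] := bar_law_exists R fib fib0.
have [Xu hXu] := underline_law_exists R fib fib0.
split.
- move=> k c f Xbar Xund H hb hu.
  have [x [_ h1 h2 h3]] := recurrence_limits R _ _ _ H.
  by split; [exists (1 - x)^-1; exact: h1| |];
    exists ((1 - x)^-1 ^+ 2 - (1 - x)^-1); [exact: h2|exact: h3].
- split; split.
  + exists 2%N, (fun=> 1%N), fib, Xu.
    by split; [exact: fib_recurrence| |exact: fE].
  + move=> l [k [c [f [X [H hX hl]]]]].
    have [x [[x01 x2 _] h1 _ _]] := recurrence_limits R _ _ _ H.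
    rewrite (unique _ _ _ hl (h1 _ hX)).
    by have [] := golden_bounds R x x01 x2.
  + exists 2%N, (fun=> 1%N), fib, Xb.
    by split; [exact: fib_recurrence| |exact: fb].
  + move=> l [k [c [f [X [H hX hl]]]]].
    have [x [[x01 x2 _] _ h2 _]] := recurrence_limits R _ _ _ H.
    rewrite (unique _ _ _ hl (h2 _ hX)).
    by have [] := golden_bounds R x x01 x2.
  + exists 2%N, (fun=> 1%N), fib, Xu.
    by split; [exact: fib_recurrence| |exact: fu].
  + move=> l [k [c [f [X [H hX hl]]]]].
    have [x [[x01 x2 _] _ _ h3]] := recurrence_limits R _ _ _ H.
    rewrite (unique _ _ _ hl (h3 _ hX)).
    by have [] := golden_bounds R x x01 x2.
- move=> c f Xbar Xund H c1 c2 hb hu.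
  have [h1 h2 h3] := Hfib c f H c1 c2.
  by split; [exact: h1|exact: h2|exact: h3].
Qed.
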